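(* Let $d,n\ge1$ with $n\equiv1\pmod d$. (a) $\breve{\mathcal E}^{(d)}_n=\sum_{\omega}(-1)^{\lceil\ell/d\rceil}C_{\lfloor\ell/d\rfloor,d}$, where the sum is over all ordered set partitions $\omega$ of $[n]$ all of whose block sizes are congruent to $1$ modulo $d$, and $\ell=\ell(\omega)$. (b) $\breve{\mathcal E}^{(d)}_n=-1+\sum_{\omega\neq([n])}(-1)^{\ell}\,\breve{\mathcal E}^{(d)}_\omega$, where the sum is over all ordered set partitions $\omega\neq([n])$ of $[n]$ with all block sizes congruent to $1$ modulo $d$, and $\ell=\ell(\omega)$. (c) $\breve{\mathcal E}_d(x)=-F_d(x)\cdot C_d\big(-F_d(x)^d\big)$. (d) $\breve{\mathcal E}_d(x)=-F_d(x)\cdot\big(1-(-1)^d\,\breve{\mathcal E}_d(x)^d\big)$.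
   Context: An ordered set partition of $[n]$ is a sequence $\omega=(B_1,\ldots,B_\ell)$ of nonempty disjoint blocks with union $[n]$; $\ell(\omega)=\ell$. Ordered set partitions are ordered by letting $(B_1,\ldots,B_k)$ be covered by each $(B_1,\ldots,B_i\cup B_{i+1},\ldots,B_k)$ (merging adjacent blocks in place), extended transitively. $\breve\Omega^{(d)}_n$ is the subposet of ordered set partitions of $[n]$ with all block sizes $\equiv1\pmod d$, with a minimum $\hat0$ adjoined; for $n\equiv 1\pmod d$ it has maximum $([n])$. Define $\breve{\mathcal E}^{(d)}_n=\mu(\hat0,\hat1)$ in $\breve\Omega^{(d)}_n$ ($\mu$ the Möbius function) if $n\equiv1\pmod d$, and $\breve{\mathcal E}^{(d)}_n=0$ otherwise; for $\omega=(B_1,\ldots,B_\ell)$, $\breve{\mathcal E}^{(d)}_\omega=\prod_i\breve{\mathcal E}^{(d)}_{\#B_i}$. Set $\breve{\mathcal E}_d(x)=\sum_{n\ge1}\breve{\mathcal E}^{(d)}_n x^n/n!$ and $F_d(x)=\sum_{m\ge0}x^{dm+1}/(dm+1)!$. The $k$-Catalan numbers are $C_{n,k}=\frac{1}{(k-1)n+1}\binom{kn}{n}$ and $C_k(x)=\sum_{n\ge0}C_{n,k}x^n$. *)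

(* Defs.v *)
From HB Require Import structures.
From mathcomp Require Import all_boot all_order all_algebra.
From mathcomp Require Import boolp.

Set Implicit Arguments.
Unset Strict Implicit.
Unset Printing Implicit Defensive.

Import Order.TTheory GRing.Theory Num.Theory.

Local Open Scope ring_scope.

Section Mobius.
Context {disp : Order.disp_t} {T : finPOrderType disp}.

(* The first argument bounds the recursion depth. A chain has at most #|T|
   elements, so [#|T|.+1] suffices: see [mobius_xx] and [mobius_lt]. *)
Fixpoint mobius_rec (k : nat) (x y : T) : int :=
  if k is k'.+1 then
    if x == y then 1
    else if (x < y)%O then - \sum_(z : T | (x <= z < y)%O) mobius_rec k' x z
    else 0
  else 0.

Definition mobius (x y : T) : int := mobius_rec #|T|.+1 x y.

Let height (y : T) := #|[pred z | (z < y)%O]|.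

Let height_lt (z y : T) : (z < y)%O -> (height z < height y)%N.
Proof.
move=> zy; apply/proper_card/properP; split.
  by apply/subsetP=> t; rewrite !inE => tz; apply: lt_trans zy.
by exists z; rewrite !inE // ltxx.
Qed.

Let mobius_recE k l (x y : T) :
  (height y < k)%N -> (height y < l)%N -> mobius_rec k x y = mobius_rec l x y.
Proof.
elim: k l y => [//|k IHk] [//|l] y hk hl /=.
case: eqP => // _; case: ifP => // _; congr (- _).
apply: eq_bigr => z /andP[_ /height_lt zy].
by apply: IHk; apply: leq_trans zy _.
Qed.

Lemma mobius_xx (x : T) : mobius x x = 1.
Proof. by rewrite /mobius /= eqxx. Qed.

Lemma mobius_lt (x y : T) : (x < y)%O ->
  mobius x y = - \sum_(z : T | (x <= z < y)%O) mobius x z.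
Proof.
move=> xy; rewrite {1}/mobius /= (lt_eqF xy) xy; congr (- _).
apply: eq_bigr => z /andP[_ /height_lt zy]; apply: mobius_recE.
  by apply: leq_trans zy _; apply: max_card.
by rewrite ltnS; apply: max_card.
Qed.

End Mobius.

Definition adjoin_min (T : Type) : Type := option T.

Section AdjoinMin.
Context {disp : Order.disp_t} {T : finPOrderType disp}.

HB.instance Definition _ := Finite.copy (adjoin_min T) (option T).

Definition adjoin_min_le (x y : adjoin_min T) : bool :=
  match x, y with
  | None, _ => true
  | Some _, None => false
  | Some a, Some b => (a <= b)%O
  end.

Fact adjoin_min_refl : reflexive adjoin_min_le.
Proof. by case=> //= a; apply: lexx. Qed.

Fact adjoin_min_anti : antisymmetric adjoin_min_le.
Proof. by case=> [a|] [b|] //= /le_anti ->. Qed.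

Fact adjoin_min_trans : transitive adjoin_min_le.
Proof. by case=> [b|] [a|] [c|] //=; apply: le_trans. Qed.

HB.instance Definition _ := Order.Le_isPOrder.Build disp (adjoin_min T)
  adjoin_min_refl adjoin_min_anti adjoin_min_trans.

Fact adjoin_min_le0x (x : adjoin_min T) : ((None : adjoin_min T) <= x)%O.
Proof. by []. Qed.

HB.instance Definition _ :=
  Order.hasBottom.Build disp (adjoin_min T) adjoin_min_le0x.

End AdjoinMin.

(* The ground set [n] is ['I_n]. *)
Definition is_osp (n : nat) (w : seq {set 'I_n}) : bool :=
  [&& set0 \notin w,
      pairwise (fun A B : {set 'I_n} => [disjoint A & B]) w
    & \bigcup_(B <- w) B == [set: 'I_n]].

(* Nonempty disjoint blocks are at most n in number, so bounding the length
   by n loses nothing ([size_is_osp]); it makes the type finite. *)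
Record osp (n : nat) : predArgType :=
  Osp { blocks :> n.-bseq {set 'I_n}; _ : is_osp blocks }.

HB.instance Definition _ (n : nat) := [isSub for @blocks n].
HB.instance Definition _ (n : nat) := [Finite of osp n by <:].

Lemma size_is_osp (n : nat) (w : seq {set 'I_n}) :
  is_osp w -> (size w <= n)%N.
Proof.
case/and3P=> w0 wI /eqP wU; rewrite -[leqRHS]card_ord -cardsT -wU {wU}.
elim: w w0 wI => [//|B w IHw] /=.
rewrite inE negb_or => /andP[B0 w0] /andP[BI wI].
rewrite big_cons cardsU (_ : B :&: _ = set0) ?cards0 ?subn0; last first.
  apply/disjoint_setI0; rewrite disjoint_sym.
  elim: w BI {IHw w0 wI} => [|C w IHw] /=.
    by rewrite big_nil disjoints_subset sub0set.
  case/andP=> BC /IHw; rewrite big_cons !disjoints_subset subUset => ->.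
  by rewrite andbT -disjoints_subset disjoint_sym.
by rewrite -add1n leq_add ?IHw // card_gt0 eq_sym.
Qed.

Section Merge.
Context {n : nat}.
Implicit Types w v : osp n.

Definition merge_adjacent w v : bool :=
  [exists i : 'I_n, (i.+1 < size w)%N &&
    (v == take i w ++ (nth set0 w i :|: nth set0 w i.+1) :: drop i.+2 w
       :> seq {set 'I_n})].

Definition osp_le : rel (osp n) := connect merge_adjacent.

Let merge_size w v : merge_adjacent w v -> (size v < size w)%N.
Proof.
case/existsP=> i /andP[iw /eqP ->].
rewrite size_cat /= size_drop size_takel; last by apply: ltnW; apply: ltnW.
by rewrite addnS -[X in (X <= _)%N]/((i.+2 + _)%N) subnKC.
Qed.

Let osp_le_size w v : osp_le w v -> w != v -> (size v < size w)%N.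
Proof.
case/connectP=> p; elim: p w => [|u p IHp] w /=.
  by move=> _ ->; rewrite eqxx.
case/andP=> /merge_size uw up vE _; have [uv|nuv] := eqVneq u v.
  by rewrite -uv.
exact: ltn_trans (IHp _ up vE nuv) uw.
Qed.

Fact osp_le_anti : antisymmetric osp_le.
Proof.
move=> w v /andP[wv vw]; apply/eqP/contraT => nwv.
have := ltn_trans (osp_le_size wv nwv) (osp_le_size vw _).
by rewrite ltnn eq_sym => ->.
Qed.

Fact osp_disp : Order.disp_t. Proof. exact: Order.Disp tt tt. Qed.

HB.instance Definition _ := Order.Le_isPOrder.Build osp_disp (osp n)
  (@connect0 _ merge_adjacent) osp_le_anti (@connect_trans _ merge_adjacent).

End Merge.

Record osp_mod (d n : nat) : predArgType := OspMod {
  osp_of :> osp n;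
  _ : all (fun B : {set 'I_n} => #|B| == 1 %[mod d]) osp_of
}.

HB.instance Definition _ (d n : nat) := [isSub for @osp_of d n].
HB.instance Definition _ (d n : nat) := [Finite of osp_mod d n by <:].
HB.instance Definition _ (d n : nat) :=
  [SubChoice_isSubPOrder of osp_mod d n by <: with osp_disp].

Definition breve_Omega (d n : nat) : Type := adjoin_min (osp_mod d n).

HB.instance Definition _ (d n : nat) :=
  Order.FinBPOrder.copy (breve_Omega d n) (adjoin_min (osp_mod d n)).

(* The element ([n]), which exists only when 0 < n and n = 1 %[mod d]; otherwise
   the value is meaningless. See [one_hatE] and [le_one_hat]. *)
Definition one_hat (d n : nat) : breve_Omega d n :=
  obind insub (insub (insub_bseq n [:: [set: 'I_n]]) : option (osp n)).

Lemma one_hatE (d n : nat) : (0 < n)%N -> n = 1 %[mod d] ->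
  exists2 w : osp_mod d n,
    one_hat d n = Some w & blocks w = [:: [set: 'I_n]] :> seq {set 'I_n}.
Proof.
move=> n0 nd.
have bE : insub_bseq n [:: [set: 'I_n]] = [:: [set: 'I_n]] :> seq {set 'I_n}.
  by rewrite /insub_bseq insubdK.
have ospT : is_osp (insub_bseq n [:: [set: 'I_n]]).
  rewrite /is_osp bE /= big_seq1 eqxx inE andbT eq_sym -card_gt0 cardsT.
  by rewrite card_ord n0.
have modT : all (fun B : {set 'I_n} => #|B| == 1 %[mod d]) (Osp ospT).
  by rewrite /= bE /= cardsT card_ord nd eqxx.
exists (OspMod modT); last by [].
rewrite /one_hat insubT /= insubT; congr Some; exact/val_inj/val_inj.
Qed.

Lemma le_one_hat (d n : nat) (x : breve_Omega d n) :
  (0 < n)%N -> n = 1 %[mod d] -> (x <= one_hat d n)%O.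
Proof.
move=> n0 nd; case: x => [u|]; last exact: le0x.
have [t -> tE] := one_hatE n0 nd.
suff: osp_le (osp_of u) (osp_of t) by [].
move: {u} (osp_of u) => u; have [m um] := ubnP (size u).
elim: m u um => // m IHm u um.
have: is_osp u by case: (u).
case uE: (blocks u : seq {set 'I_n}) => [|A [|B s]].
- rewrite /is_osp big_nil => /and3P[_ _ /eqP/setP/(_ (Ordinal n0))].
  by rewrite !inE.
- rewrite /is_osp big_seq1 => /and3P[_ _ /eqP AT].
  suff -> : u = osp_of t by apply: connect0.
  by do 2![apply: val_inj]; rewrite /= uE tE AT.
rewrite /is_osp !inE !negb_or !big_cons /= => uP.
have vP : is_osp (A :|: B :: s).
  case/and3P: uP => /and3P[A0 B0 s0] /and3P[/andP[AB As] Bs sI] sU.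
  rewrite /is_osp !inE negb_or big_cons -setUA sU s0 /= sI !andbT.
  rewrite eq_sym setU_eq0 negb_and eq_sym A0 /=.
  apply/allP=> C Cs; rewrite disjoints_subset subUset -!disjoints_subset.
  by rewrite (allP As) // (allP Bs).
have vn : (size (A :|: B :: s) <= n)%N by apply: size_is_osp.
pose v := @Osp n (@Bseq n _ (A :|: B :: s) vn) vP.
apply: (connect_trans (y := v)); last first.
  by apply: IHm; move: um; rewrite uE /= !ltnS.
apply/connect1/existsP; exists (Ordinal n0).
by rewrite uE /= drop0.
Qed.

(* For d = 1 the residue test accepts n = 0, where the value is junk; it is
   never used, since blocks are nonempty and the series starts at n = 1. *)
Definition breve_E (d n : nat) : int :=
  if n == 1 %[mod d] then mobius (\bot : breve_Omega d n)%O (one_hat d n) else 0.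

Definition breve_E_osp (d n : nat) (w : osp n) : int :=
  \prod_(B <- w) breve_E d #|B|.

Record fps (R : Type) := Fps { coefs : nat -> R }.

HB.instance Definition _ (R : Type) := gen_eqMixin (fps R).
HB.instance Definition _ (R : Type) := gen_choiceMixin (fps R).

Lemma fpsP (R : Type) (f g : fps R) : coefs f =1 coefs g <-> f = g.
Proof. by split=> [|-> //]; case: f g => [f] [g] /= /funext ->. Qed.

Section FpsRing.
Variable R : comNzRingType.
Implicit Types f g h : fps R.

Definition fps_add f g := Fps (fun n => coefs f n + coefs g n).
Definition fps_opp f := Fps (fun n => - coefs f n).
Definition fps_mul f g :=
  Fps (fun n => \sum_(i < n.+1) coefs f i * coefs g (n - i)%N).
Definition fps_const (a : R) := Fps (fun n => if n is 0 then a else 0).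

Fact fps_addA : associative fps_add.
Proof. by move=> f g h; apply/fpsP=> n /=; rewrite addrA. Qed.
Fact fps_addC : commutative fps_add.
Proof. by move=> f g; apply/fpsP=> n /=; rewrite addrC. Qed.
Fact fps_add0 : left_id (fps_const 0) fps_add.
Proof. by move=> f; apply/fpsP=> -[|n] /=; rewrite add0r. Qed.
Fact fps_addN : left_inverse (fps_const 0) fps_opp fps_add.
Proof. by move=> f; apply/fpsP=> -[|n] /=; rewrite addNr. Qed.

HB.instance Definition _ :=
  GRing.isZmodule.Build (fps R) fps_addA fps_addC fps_add0 fps_addN.

Let trunc N f : {poly R} := \poly_(i < N) coefs f i.

Let coef_mul f g N n : (n < N)%N ->
  coefs (fps_mul f g) n = (trunc N f * trunc N g)`_n.
Proof.
move=> nN; rewrite coefM; apply: eq_bigr => i _; rewrite !coef_poly.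
by rewrite (leq_ltn_trans _ nN) ?(leq_ltn_trans (leq_subr _ _) nN) // -ltnS.
Qed.

Fact fps_mulA : associative fps_mul.
Proof.
move=> f g h; apply/fpsP=> n; have nn := ltnSn n.
have tE k l : (l < n.+1)%N -> (trunc n.+1 k)`_l = coefs k l.
  by move=> ln; rewrite coef_poly ln.
transitivity (trunc n.+1 f * (trunc n.+1 g * trunc n.+1 h))`_n.
  rewrite coefM; apply: eq_bigr => i _.
  by rewrite tE // (coef_mul _ _ (N := n.+1)) // ltnS leq_subr.
rewrite mulrA coefM; apply: eq_bigr => i _.
by rewrite tE ?ltnS ?leq_subr // (coef_mul _ _ (N := n.+1)).
Qed.

Fact fps_mulC : commutative fps_mul.
Proof.
by move=> f g; apply/fpsP=> n; rewrite !(coef_mul _ _ (ltnSn n)) mulrC.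
Qed.

Fact fps_mul1 : left_id (fps_const 1) fps_mul.
Proof.
move=> f; apply/fpsP=> n /=; rewrite big_ord_recl /= mul1r subn0 big1 ?addr0 //.
by move=> i _; rewrite mul0r.
Qed.

Fact fps_mulDl : left_distributive fps_mul fps_add.
Proof.
move=> f g h; apply/fpsP=> n /=; rewrite -big_split /=.
by apply: eq_bigr => i _; rewrite mulrDl.
Qed.

Fact fps_1neq0 : fps_const 1 != 0.
Proof.
by apply/eqP=> /fpsP/(_ 0%N) /= /eqP; rewrite (negbTE (oner_neq0 R)).
Qed.

HB.instance Definition _ := GRing.Zmodule_isComNzRing.Build (fps R)
  fps_mulA fps_mulC fps_mul1 fps_mulDl fps_1neq0.

End FpsRing.

(* The composite f(g(x)), for g with zero constant term: the powers g ^+ k with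
   k > n then do not contribute to the coefficient of x^n. *)
Definition fps_comp (R : comNzRingType) (f g : fps R) : fps R :=
  Fps (fun n => \sum_(k < n.+1) coefs f k * coefs (g ^+ k) n).

(* Meant for k >= 1, so that [k.-1] is a true predecessor. *)
Definition kCatalan (n k : nat) : rat :=
  ((k.-1 * n).+1)%:R^-1 * 'C(k * n, n)%:R.

Definition kCatalan_series (k : nat) : fps rat := Fps (fun n => kCatalan n k).

Definition breve_E_series (d : nat) : fps rat :=
  Fps (fun n => if (0 < n)%N then (breve_E d n)%:~R / n`!%:R else 0).

(* For d >= 1, the exponents d m + 1 (m >= 0) are the n > 0 with n = 1 mod d. *)
Definition F_series (d : nat) : fps rat :=
  Fps (fun n => if (0 < n)%N && (n == 1 %[mod d]) then n`!%:R^-1 else 0).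

(* The ceiling of l / d, for d >= 1. *)
Definition ceil_div (l d : nat) : nat := (l %/ d + ~~ (d %| l))%N.

(* Main.v *)
Require Import Defs.
From mathcomp Require Import all_boot all_order all_algebra.
From mathcomp Require Import ring zify.

Import Order.TTheory GRing.Theory Num.Theory.
Local Open Scope ring_scope.

(* Put [c = C_d(-F^d)] and [G = F c]. The equation [C_d(t) = 1 + t C_d(t)^d] gives
   [G = F (1 - G^d)], so [F = G / (1 - G^d)] is the sum of the powers [G^l] with [l = 1 mod d].
   Reading off exponential generating functions, the weights [eta_n = n! [x^n] G] satisfy
   [sum_u prod_(A in u) eta_#|A| = 1], where [u] ranges over the admissible ordered set
   partitions of any admissible block. The elements below a partition [w] are the concatenations
   of ordered set partitions of its blocks, so [- prod_(B in w) eta_#|B|] solves the recursion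
   defining [mu(0, w)]. Hence the breve numbers are the [- eta_n], and (a)-(d) are
   properties of [G]. *)

(** * Formal power series *)

Section FpsCoefs.
Variable R : comNzRingType.
Implicit Types (f g h : fps R) (a : R).

Lemma coefsD f g n : coefs (f + g) n = coefs f n + coefs g n.
Proof. by []. Qed.

Lemma coefsN f n : coefs (- f) n = - coefs f n.
Proof. by []. Qed.

Lemma coefsM f g n :
  coefs (f * g) n = \sum_(i < n.+1) coefs f i * coefs g (n - i)%N.
Proof. by []. Qed.

Lemma coefs0 n : coefs (0 : fps R) n = 0.
Proof. by case: n. Qed.

Lemma coefs1 n : coefs (1 : fps R) n = (n == 0%N)%:R.
Proof. by case: n. Qed.

Lemma coefs_sum (I : Type) (r : seq I) (P : pred I) (f : I -> fps R) n :
  coefs (\sum_(i <- r | P i) f i) n = \sum_(i <- r | P i) coefs (f i) n.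
Proof.
by apply: (big_morph (fun h => coefs h n)) => [g h|]; rewrite ?coefs0.
Qed.

Lemma coefs_comp (a : nat -> R) g n :
  coefs (fps_comp (Fps a) g) n = \sum_(k < n.+1) a k * coefs (g ^+ k) n.
Proof. by []. Qed.

Lemma coefs_exp_eq0 g k n : coefs g 0 = 0 -> (n < k)%N -> coefs (g ^+ k) n = 0.
Proof.
move=> g0; elim: k n => // k IHk n nk; rewrite exprS coefsM big1 // => -[[|i] /= ilt] _.
  by rewrite g0 mul0r.
by rewrite IHk ?mulr0 //; lia.
Qed.

(** The power [g ^+ k] starts in degree at least [k], so the added terms are zero. A bound
    independent of [m] is what allows sums to be exchanged in [coefs_mul_comp]. *)
Lemma coefs_comp_widen (a : nat -> R) g m n : coefs g 0 = 0 -> (m <= n)%N ->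
  coefs (fps_comp (Fps a) g) m = \sum_(k < n.+1) a k * coefs (g ^+ k) m.
Proof.
move=> g0 mn; pose t k := a k * coefs (g ^+ k) m.
rewrite coefs_comp -(big_mkord xpredT t) -[RHS](big_mkord xpredT t).
rewrite [RHS](big_cat_nat (n := m.+1)) //= [X in _ + X]big_nat.
rewrite [X in _ + X]big1 ?addr0 // => i /andP[mi _].
by rewrite /t coefs_exp_eq0 ?mulr0.
Qed.

Lemma coefs_mul_comp (a : nat -> R) f g n : coefs g 0 = 0 ->
  coefs (f * fps_comp (Fps a) g) n = \sum_(k < n.+1) a k * coefs (f * g ^+ k) n.
Proof.
move=> g0; rewrite coefsM.
under [RHS]eq_bigr => k _ do rewrite coefsM mulr_sumr.
rewrite exchange_big; apply: eq_bigr => i _.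
rewrite (coefs_comp_widen a _ _ n) ?leq_subr // mulr_sumr.
by apply: eq_bigr => k _; rewrite mulrCA.
Qed.

Lemma coefs_signM f k n : coefs ((-1) ^+ k * f) n = (-1) ^+ k * coefs f n.
Proof.
rewrite -signr_odd -[in RHS]signr_odd; case: odd; last by rewrite !expr0 !mul1r.
by rewrite !expr1 !mulN1r.
Qed.

(** A factor without constant term raises degrees, which drives inductions on the degree. *)
Lemma coefsM_eq_lt g f h n : coefs g 0 = 0 ->
  (forall m, (m < n)%N -> coefs f m = coefs h m) ->
  coefs (g * f) n = coefs (g * h) n.
Proof.
move=> g0 fh; rewrite !coefsM; apply: eq_bigr => -[[|i] /= ilt] _.
  by rewrite g0 !mul0r.
by rewrite fh //; lia.
Qed.

(** * Series supported in one residue class *)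

Definition mod_supp (d r : nat) f :=
  forall n, coefs f n != 0 -> n = r %[mod d].

Lemma mod_suppM d r s f g : mod_supp d r f -> mod_supp d s g ->
  mod_supp d (r + s) (f * g).
Proof.
move=> fr gs n; rewrite coefsM; apply: contraNeq => nrs; apply/eqP.
apply: big1 => -[i /= ilt] _.
have [->|/fr fi] := eqVneq (coefs f i) 0; first by rewrite mul0r.
have [->|/gs gi] := eqVneq (coefs g (n - i)%N) 0; first by rewrite mulr0.
case/negP: nrs; apply/eqP.
by rewrite -modnDm -fi -gi modnDm; congr (_ %% _)%N; lia.
Qed.

Lemma mod_supp_exp d r f k : mod_supp d r f -> mod_supp d (k * r) (f ^+ k).
Proof.
move=> fr; elim: k => [|k IHk]; last by rewrite exprS mulSn; apply: mod_suppM.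
by move=> n; rewrite coefs1; case: n => //= n; rewrite eqxx.
Qed.

Lemma mod_suppN d r f : mod_supp d r f -> mod_supp d r (- f).
Proof. by move=> fr n; rewrite coefsN oppr_eq0; apply: fr. Qed.

Lemma mod_supp_comp d f g : mod_supp d 0 g -> mod_supp d 0 (fps_comp f g).
Proof.
move=> g0 n; apply: contraNeq => /eqP nd; apply/eqP; apply: big1 => k _.
have [->|/(mod_supp_exp d 0 g k g0)] := eqVneq (coefs (g ^+ k) n) 0.
  by rewrite mulr0.
by rewrite muln0.
Qed.

(* [f ^+ l] lives in degrees congruent to [l] modulo [d]. *)
Lemma sum_mod_supp d (phi : nat -> R) f m : (0 < d)%N -> (0 < m)%N ->
  m = 1 %[mod d] -> coefs f 0 = 0 -> mod_supp d 1 f ->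
  \sum_(l < m.+1) phi l * coefs (f ^+ l) m =
  \sum_(k < m.+1) phi (d * k).+1 * coefs (f ^+ (d * k).+1) m.
Proof.
move=> d0 m0 md f0 fd; pose t l := phi l * coefs (f ^+ l) m.
have t0 l : (m < l)%N -> t l = 0.
  by move=> ml; rewrite /t coefs_exp_eq0 ?mulr0.
have tmod l : l <> 1 %[mod d] -> t l = 0.
  move=> ld; rewrite /t; have [->|] := eqVneq (coefs (f ^+ l) m) 0.
    by rewrite mulr0.
  by move/(mod_supp_exp d 1 f l fd); rewrite muln1 md => /esym.
have tz : t 0%N = 0 by rewrite /t coefs1 eqn0Ngt m0 mulr0.
rewrite -(big_mkord xpredT t) -(big_mkord xpredT (fun k => t (d * k).+1)).
(* The range is extended by zero terms so that, once [l = 0] is removed, it splits into [m.+1] runs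
   of length [d], each with [d * k + 1] as its only index in the right class. *)
have -> : \sum_(0 <= l < m.+1) t l = \sum_(0 <= l < (d * m.+1).+1) t l.
  rewrite [RHS](big_cat_nat (n := m.+1)) //=; last by nia.
  rewrite [X in _ = _ + X]big_nat [X in _ = _ + X]big1 ?addr0 // => l /andP[ml _].
  exact: t0.
rewrite [LHS]big_nat_recl // tz add0r; elim: m.+1 => [|k IHk].
  by rewrite muln0 !big_geq.
rewrite mulnSr [LHS](big_cat_nat (n := (d * k)%N)) ?leq_addr //= IHk.
rewrite [RHS]big_nat_recr //=; congr (_ + _).
rewrite -{1}[(d * k)%N]add0n big_addn [(_ + d - _)%N]addKn.
case: d d0 {md fd IHk} tmod => // d _ tmod.
rewrite big_nat_recl // add0n big_nat big1 ?addr0 // => i /andP[_ id].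
apply: tmod => /eqP.
rewrite (_ : (i.+1 + d.+1 * k).+1 = (k * d.+1 + i.+1 + 1)%N); last by nia.
rewrite -[X in _ == (X %% _)%N]add0n eqn_modDr mod0n.
by rewrite modnMDl modn_small.
Qed.

End FpsCoefs.

Arguments mod_supp {R}.

(** * Raney numbers *)

(* The coefficient of [t^n] in [B^r], where [B = 1 + t B^k]. It equals
   [r / (k n + r) * 'C(k n + r, n)]; the form below also makes sense at [r = 0]. *)
Definition raney (k n r : nat) : rat :=
  if n is m.+1 then r%:R / n%:R * 'C((k * n + r).-1, m)%:R else 1.
Arguments raney : simpl never.

(** This is [B^(r+1) = B^r + t B^(r+k)], the equation for [B] times [B^r], read on coefficients. *)
Lemma raneyS k n r : (0 < k)%N ->
  raney k n.+1 r.+1 = raney k n.+1 r + raney k n (r + k).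
Proof.
case: k => // k _; case: n => [|n]; rewrite /raney.
  by rewrite !bin0 !mulr1n !divr1 -natr1.
(* The binomials have upper index [N] or [N.+1]; all become multiples of ['C(N, n)], which leaves an
   identity of rational functions. *)
set N := ((k.+1 * n.+2 + r).-1).
have -> : ((k.+1 * n.+2 + r.+1).-1 = N.+1)%N by rewrite /N; nia.
have -> : ((k.+1 * n.+1 + (r + k.+1)).-1 = N)%N by rewrite /N; nia.
have Nn : (n <= N)%N by rewrite /N; nia.
have := mul_bin_left N n; rewrite binS natrD => /(congr1 (fun i => i%:R : rat)).
rewrite !natrM natrB // => eqb.
have NE : N%:R = (k.+1%:R * n.+2%:R + r%:R - 1) :> rat.
  by rewrite -natrM -natrD -[N%:R](addrK 1) natr1 prednK.
have n1 : n.+1%:R != 0 :> rat by rewrite pnatr_eq0.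
have n2 : n.+2%:R != 0 :> rat by rewrite pnatr_eq0.
have -> : 'C(N, n.+1)%:R = (N%:R - n%:R) * 'C(N, n)%:R / n.+1%:R :> rat.
  by rewrite -eqb mulrC mulKf.
rewrite NE natrD -!(natr1 n.+1) -!(natr1 n) -!(natr1 r) in n1 n2 *.
by field; rewrite n1 n2.
Qed.

Lemma raney1 k n : (0 < k)%N -> raney k n 1 = kCatalan n k.
Proof.
case: k => // k _; rewrite /kCatalan /raney [k.+1.-1]/=; case: n => [|n].
  by rewrite muln0 !bin0 mulr1 invr1.
rewrite addn1 /=; have := mul_bin_left (k.+1 * n.+1) n.
have -> : (k.+1 * n.+1 - n = (k * n.+1).+1)%N by nia.
move/(congr1 (fun i => i%:R : rat)); rewrite !natrM => eqb.
have n1 : n.+1%:R != 0 :> rat by rewrite pnatr_eq0.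
have kn : (k * n.+1).+1%:R != 0 :> rat by rewrite pnatr_eq0.
by rewrite mul1r; apply: (mulfI n1); rewrite mulVKf // mulrCA eqb mulKf.
Qed.

(** Strong induction on the degree, then induction on [r]. The recursion brings in the index
    [r + k], possibly larger, but only behind the factor [g], which sees strictly lower degrees. *)
Lemma raney_family_mul (R : comNzRingType) (k : nat) (g : fps R) (X : nat -> fps R) :
  coefs g 0 = 0 -> X 0%N = 1 ->
  (forall r, X r.+1 = X r + g * X (r + k)%N) ->
  forall r s, X r * X s = X (r + s)%N.
Proof.
move=> g0 X0 XS r s; apply/fpsP => n; elim/ltn_ind: n r s => n IHn r s.
elim: r => [|r IHr]; first by rewrite X0 mul1r.
rewrite addSn !XS mulrDl !coefsD IHr -mulrA; congr (_ + _).
by apply: coefsM_eq_lt => // m mn; rewrite IHn // addnAC.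
Qed.

Lemma comp_raneyS (k : nat) (g : fps rat) r : (0 < k)%N -> coefs g 0 = 0 ->
  fps_comp (Fps (raney k ^~ r.+1)) g =
  fps_comp (Fps (raney k ^~ r)) g + g * fps_comp (Fps (raney k ^~ (r + k)%N)) g.
Proof.
move=> k0 g0; apply/fpsP => n; rewrite coefsD !coefs_comp.
rewrite big_ord_recl [X in _ = X + _]big_ord_recl -addrA; congr (_ + _).
under eq_bigr => i _ do rewrite lift0 raneyS // mulrDl.
rewrite big_split; congr (_ + _).
(* The sum for the product has one more term, containing [g ^+ n.+1], whose coefficient in degree
   [n] is zero. *)
rewrite coefs_mul_comp // big_ord_recr -[RHS]/(_ + _).
rewrite -exprS coefs_exp_eq0 // mulr0 addr0.
by apply: eq_bigr => i _; rewrite -exprS.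
Qed.

(** The family [X] is multiplicative in its index, so [X r] is the [r]-th power of [X 1], and the
    recursion at [r = 0] becomes the functional equation. *)
Lemma comp_kCatalan (k : nat) (g : fps rat) : (0 < k)%N -> coefs g 0 = 0 ->
  let c := fps_comp (kCatalan_series k) g in c = 1 + g * c ^+ k.
Proof.
move=> k0 g0 /=; pose X r := fps_comp (Fps (raney k ^~ r)) g.
have X0 : X 0%N = 1.
  apply/fpsP => n; rewrite coefs_comp big_ord_recl big1 ?addr0 ?mul1r // => i _.
  by rewrite lift0 /raney !mul0r.
have XS r : X r.+1 = X r + g * X (r + k)%N by apply: comp_raneyS.
have XM := raney_family_mul _ _ _ _ g0 X0 XS.
have -> : fps_comp (kCatalan_series k) g = X 1%N.
  by apply/fpsP => n; apply: eq_bigr => i _; rewrite /= raney1.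
have XE r : X 1%N ^+ r = X r.
  by elim: r => [|r IHr]; rewrite ?expr0 // exprS IHr XM.
by rewrite XE {1}XS X0.
Qed.

(** * Ordered set partitions of a finite set *)

(** Locates a marked entry in one of two concatenated lists; in [refinements_split] the entry is a
    merged block. *)
Lemma cat_eq_cat_cons (T : Type) (x : T) (p s v u : seq T) : p ++ x :: s = v ++ u ->
  (exists2 p', p = v ++ p' & u = p' ++ x :: s) \/
  (exists2 s', v = p ++ x :: s' & s = s' ++ u).
Proof.
elim: v p => [|y v IHv] [|z p] /=.
- by move=> <-; left; exists [::].
- by move=> <-; left; exists (z :: p).
- by case=> <- ->; right; exists v.
case=> <- /IHv[[p' -> ->]|[s' -> ->]]; first by left; exists p'.
by right; exists s'.
Qed.

Section OspOn.
Variable T : finType.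
Implicit Types (S A B C : {set T}) (p s u v w : seq {set T}).

(** A recursive form of [is_osp] over any ground set, so that blocks can themselves be partitioned;
    [is_ospE] relates the two. *)
Fixpoint osp_on S w :=
  if w is B :: w' then [&& B != set0, B \subset S & osp_on (S :\: B) w']
  else S == set0.

Lemma osp_on_bigcup S w : osp_on S w -> \bigcup_(B <- w) B = S.
Proof.
elim: w S => [|B w IHw] S /=; first by rewrite big_nil => /eqP.
case/and3P=> _ BS /IHw; rewrite big_cons => ->.
by rewrite setDE setUIr setUCr setIT; apply/setUidPr.
Qed.

Lemma osp_on_cat S v u :
  osp_on S (v ++ u) =
  [&& \bigcup_(B <- v) B \subset S, osp_on (\bigcup_(B <- v) B) v
    & osp_on (S :\: \bigcup_(B <- v) B) u].
Proof.
elim: v S => [|B v IHv] S /=; first by rewrite big_nil sub0set eqxx setD0.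
rewrite big_cons IHv; set U := \bigcup_(C <- v) C.
apply/and5P/and3P.
  case=> B0 BS; rewrite subsetD => /andP[US UB] vU; rewrite setDDl => uS.
  rewrite subUset BS US subsetUl B0 setDUl setDv set0U.
  by move: UB vU; rewrite disjoint_sym disjoint_sym => /setDidPl ->.
case; rewrite subUset => /andP[BS US] /and3P[B0 _ vU] uS.
have UB : [disjoint U & B].
  have := osp_on_bigcup _ _ vU; rewrite -/U setDUl setDv set0U => UE.
  by apply/setDidPl.
move: vU; rewrite setDUl setDv set0U (setDidPl UB) => vU.
by split; rewrite ?subsetD ?US ?setDDl.
Qed.

Lemma osp_on_block S w B : osp_on S w -> B \in w -> B != set0 /\ B \subset S.
Proof.
elim: w S => //= C w IHw S /and3P[C0 CS wS]; rewrite inE => /predU1P[-> //|].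
case/(IHw _ wS) => B0 BS; split=> //; apply: subset_trans BS _.
exact: subsetDl.
Qed.

Lemma osp_on_merge S p A B s :
  osp_on S (p ++ A :: B :: s) =
  [&& osp_on S (p ++ (A :|: B) :: s), A != set0, B != set0
    & [disjoint A & B]].
Proof.
rewrite !osp_on_cat /=; set X := S :\: _.
rewrite setU_eq0 subUset subsetD setDDl disjoint_sym.
by case: (_ \subset S); case: (osp_on _ p); case: (A == set0);
  case: (B == set0); case: (A \subset X); case: (B \subset X);
  case: [disjoint A & B] => //=; rewrite ?andbT ?andbF.
Qed.

Lemma size_osp_on S w : osp_on S w -> (size w <= #|S|)%N.
Proof.
elim: w S => //= B w IHw S /and3P[B0 BS /IHw wS].
have := cardsID B S; rewrite (setIidPr BS).
by move: B0; rewrite -card_gt0; lia.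
Qed.

(** Graded by the number of blocks, so that choosing the first block mirrors
    [f ^+ k.+1 = f * f ^+ k] for generating functions. *)
Fixpoint osps_of_size k S : seq (seq {set T}) :=
  if k is k'.+1 then
    [seq B :: w | B <- [seq B <- index_enum {set T} | (B != set0) && (B \subset S)],
                  w <- osps_of_size k' (S :\: B)]
  else if S == set0 then [:: [::]] else [::].

Lemma mem_osps_of_size k S w :
  (w \in osps_of_size k S) = (size w == k) && osp_on S w.
Proof.
elim: k S w => [|k IHk] S w /=.
  by case: w => [|B w] /=; case: eqVneq.
apply/allpairsPdep/andP.
  case=> B [u []]; rewrite mem_filter mem_index_enum andbT IHk => /andP[B0 BS].
  by case/andP=> /eqP uk uS ->; rewrite /= uk B0 BS.
case: w => [|B w] []; first by [].
rewrite /= eqSS => wk /and3P[B0 BS wS]; exists B, w.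
by rewrite mem_filter mem_index_enum B0 BS IHk wS wk.
Qed.

Lemma uniq_osps_of_size k S : uniq (osps_of_size k S).
Proof.
elim: k S => [|k IHk] S /=; first by case: ifP.
apply: allpairs_uniq_dep => [|B _|].
- by rewrite filter_uniq ?index_enum_uniq.
- exact: IHk.
by move=> [B w] [C u] _ _ /= [-> ->].
Qed.

Definition osps S : seq (seq {set T}) :=
  [seq w | k <- iota 0 #|S|.+1, w <- osps_of_size k S].

Lemma mem_osps S w : (w \in osps S) = osp_on S w.
Proof.
apply/allpairsPdep/idP.
  by case=> k [u [_]]; rewrite mem_osps_of_size => /andP[_ uS] ->.
move=> wS; exists (size w), w.
by rewrite mem_osps_of_size eqxx wS mem_iota /= add0n ltnS size_osp_on.
Qed.

Lemma uniq_osps S : uniq (osps S).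
Proof.
apply: allpairs_uniq_dep => [|k _|]; rewrite ?iota_uniq ?uniq_osps_of_size //.
move=> [k w] [l u] /allpairsPdep[k' [w' [_ + [-> ->]]]].
rewrite mem_osps_of_size => /andP[/eqP <- _].
move=> /allpairsPdep[l' [u' [_ + [-> ->]]]].
by rewrite mem_osps_of_size => /andP[/eqP <- _] /= ->.
Qed.

(** The concatenations of ordered set partitions of the successive blocks of [w]; [osp_leE] shows
    that they form the down-set of [w]. *)
Definition refinements w : seq (seq {set T}) :=
  foldr (fun B L => [seq v ++ u | v <- osps B, u <- L]) [:: [::]] w.

Lemma refinements_consP B w u :
  reflect (exists v u', [/\ u = v ++ u', osp_on B v & u' \in refinements w])
          (u \in refinements (B :: w)).
Proof.
apply: (iffP allpairsP) => /=.
  by case=> -[v u'] /= [+ uw ->]; rewrite mem_osps => vB; exists v, u'.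
by case=> v [u' [-> vB uw]]; exists (v, u'); rewrite mem_osps.
Qed.

Lemma osp_on_refinements S w u :
  osp_on S w -> u \in refinements w -> osp_on S u.
Proof.
elim: w S u => [|B w IHw] S u /=; first by rewrite inE => + /eqP ->.
case/and3P=> _ BS wS /refinements_consP[v [u' [-> vB /(IHw _ _ wS) uS]]].
by rewrite osp_on_cat (osp_on_bigcup _ _ vB) BS vB.
Qed.

(** A concatenation [v ++ u] determines [v], as the sublist of blocks contained in [B]. *)
Lemma uniq_refinements S w : osp_on S w -> uniq (refinements w).
Proof.
elim: w S => //= B w IHw S /and3P[B0 BS wS].
apply: allpairs_uniq; rewrite ?uniq_osps ?(IHw _ wS) //.
have vB v : v \in osps B -> all (fun A => A \subset B) v.
  rewrite mem_osps => vB; apply/allP=> A /(osp_on_block _ _ _ vB)[] //.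
have uB u : u \in refinements w -> all (fun A => ~~ (A \subset B)) u.
  move=> /(osp_on_refinements _ _ _ wS) uS; apply/allP=> A.
  case/(osp_on_block _ _ _ uS)=> /set0Pn[x xA] /subsetP/(_ x xA).
  by rewrite inE => /andP[xB _]; apply: contra xB => /subsetP/(_ x xA).
have fv v u : v \in osps B -> u \in refinements w ->
    [seq A : {set T} <- v ++ u | A \subset B] = v.
  move=> /vB vb /uB ub; rewrite filter_cat (all_filterP vb).
  suff /eqP -> : [seq A : {set T} <- u | A \subset B] == [::] by rewrite cats0.
  by rewrite -[_ == _]negbK -has_filter -all_predC.
move=> [v u] [v' u'] /allpairsP[[v1 u1] /= [v1B u1w [-> ->]]].
case/allpairsP=> -[v2 u2] /= [v2B u2w [-> ->]] eq12.
have v12 : v1 = v2 by rewrite -(fv v1 u1) // eq12 fv.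
by move: eq12; rewrite v12 => /eqP; rewrite eqseq_cat // eqxx => /eqP ->.
Qed.

Lemma refinements_refl S w : osp_on S w -> w \in refinements w.
Proof.
elim: w S => //= B w IHw S /and3P[B0 BS wS].
apply/refinements_consP; exists [:: B], w.
by rewrite /= B0 subxx setDv eqxx (IHw _ wS).
Qed.

(** The block [A :|: B] lies either in the part that partitions the first block of [w] or in the
    part that refines the others; splitting it stays within that part. *)
Lemma refinements_split w p A B s :
    A != set0 -> B != set0 -> [disjoint A & B] ->
  p ++ (A :|: B) :: s \in refinements w -> p ++ A :: B :: s \in refinements w.
Proof.
move=> A0 B0 AB; elim: w p => [|C w IHw] p; first by case: p.
case/refinements_consP=> v [u [vu vC uw]]; apply/refinements_consP.
case: (cat_eq_cat_cons _ _ _ _ _ _ vu) => [[p' pE uE]|[s' vE sE]].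
  exists v, (p' ++ A :: B :: s); rewrite pE catA vC; split=> //.
  by apply: IHw; rewrite -uE.
exists (p ++ A :: B :: s'), u; rewrite sE -catA; split=> //.
by rewrite osp_on_merge -vE vC A0 B0.
Qed.

(** Refining is an independent choice in each block, and the weight is multiplicative. *)
Lemma sum_refinements (R : comNzRingType) (h : {set T} -> R) w :
  \sum_(u <- refinements w) \prod_(A <- u) h A =
  \prod_(B <- w) \sum_(v <- osps B) \prod_(A <- v) h A.
Proof.
elim: w => [|B w IHw] /=; first by rewrite big_seq1 !big_nil.
rewrite big_cons -IHw big_allpairs_dep big_distrlr.
by apply: eq_bigr => v _; apply: eq_bigr => u _; rewrite big_cat.
Qed.

(** * Exponential generating functions *)

Lemma sum_subset_card (R : pzRingType) S (phi : nat -> R) :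
  \sum_(B : {set T} | B \subset S) phi #|B| =
  \sum_(j < #|S|.+1) phi j *+ 'C(#|S|, j).
Proof.
rewrite (partition_big (fun B : {set T} => inord #|B| : 'I_(#|S|.+1)) xpredT) //=.
apply: eq_bigr => j _; rewrite -cards_draws -sumr_const.
have blockE (B : {set T}) :
    (B \subset S) && (inord #|B| == j) = (B \in [set A : {set T} | A \subset S & #|A| == j]).
  rewrite inE; case BS: (B \subset S) => //=.
  by rewrite -val_eqE /= inordK // ltnS subset_leq_card.
rewrite (eq_bigl _ _ blockE); apply: eq_bigr => B.
by rewrite inE => /andP[_ /eqP ->].
Qed.

Definition egf (eta : nat -> rat) : fps rat :=
  Fps (fun n => if (0 < n)%N then eta n / n`!%:R else 0).

(** The product rule for exponential generating functions: the binomial counting the first blocks of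
    size [j] is absorbed by the factorials. *)
Lemma sum_osps_of_size (eta : nat -> rat) k S :
  \sum_(w <- osps_of_size k S) \prod_(B <- w) eta #|B| =
  coefs (egf eta ^+ k) #|S| * #|S|`!%:R.
Proof.
elim: k S => [|k IHk] S.
  rewrite [osps_of_size _ _]/= expr0 coefs1 cards_eq0; case: (S =P set0) => [->|_].
    by rewrite big_seq1 big_nil cards0 mulr1.
  by rewrite big_nil mul0r.
rewrite big_allpairs_dep big_filter.
(* The value 0 at [j = 0] excludes the empty block, like the zero constant term of [egf]. *)
pose phi j := if (0 < j)%N then eta j
    * (coefs (egf eta ^+ k) (#|S| - j)%N * (#|S| - j)`!%:R) else 0.
transitivity (\sum_(B : {set T} | B \subset S) phi #|B|).
  rewrite [RHS](bigID (fun B => B == set0)) /= [X in _ = X + _]big1 ?add0r.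
    under [RHS]eq_bigl => B do rewrite andbC.
    apply: eq_bigr => B /andP[B0 BS]; rewrite /phi card_gt0 B0.
    under eq_bigr => w _ do rewrite big_cons.
    by rewrite -mulr_sumr IHk cardsD (setIidPr BS).
  by move=> B /andP[_ /eqP ->]; rewrite /phi cards0.
rewrite (sum_subset_card _ S phi) exprS coefsM mulr_suml; apply: eq_bigr => -[j jS] _.
rewrite [nat_of_ord _]/=.
case: j jS => [|j] jS; first by rewrite mul0rn !mul0r.
rewrite {}/phi ltn0Sn (_ : coefs (egf eta) j.+1 = eta j.+1 / j.+1`!%:R) //.
rewrite -[_ *+ 'C(_, _)]mulr_natr.
have <- : 'C(#|S|, j.+1)%:R * (j.+1`!%:R * (#|S| - j.+1)`!%:R) = #|S|`!%:R :> rat.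
  by rewrite -!natrM bin_fact.
have jn0 : j.+1`!%:R != 0 :> rat by rewrite pnatr_eq0 -lt0n fact_gt0.
by field.
Qed.

Lemma sum_osps (eta phi : nat -> rat) S :
  \sum_(w <- osps S) phi (size w) * \prod_(B <- w) eta #|B| =
  \sum_(k < #|S|.+1) phi k * coefs (egf eta ^+ k) #|S| * #|S|`!%:R.
Proof.
rewrite big_allpairs_dep -{1}[#|S|.+1]subn0 -/(index_iota _ _) big_mkord.
apply: eq_bigr => k _; rewrite -mulrA -sum_osps_of_size mulr_sumr.
rewrite big_seq [RHS]big_seq; apply: eq_bigr => w.
by rewrite mem_osps_of_size => /andP[/eqP -> _].
Qed.

End OspOn.

Arguments osp_on {T}.
Arguments osps {T}.
Arguments refinements {T}.

Lemma is_ospE n (w : seq {set 'I_n}) : is_osp w = osp_on setT w.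
Proof.
rewrite /is_osp; elim: w setT => [|B w IHw] S /=.
  by rewrite big_nil eq_sym.
rewrite -IHw inE negb_or eq_sym big_cons.
have -> : all (fun C : {set 'I_n} => [disjoint B & C]) w =
    [disjoint B & \bigcup_(C <- w) C].
  elim: w {IHw} => [|C w /= ->]; first by rewrite big_nil -setI_eq0 setI0 eqxx.
  by rewrite big_cons -!setI_eq0 setIUr setU_eq0.
set U := \bigcup_(C <- w) C; rewrite -!andbA; congr (_ && _).
suff BU : [disjoint B & U] && (B :|: U == S) = (B \subset S) && (U == S :\: B).
  by case: (_ \notin w); case: (pairwise _ w); rewrite ?andbF ?andTb // BU.
apply/andP/andP=> [[BU /eqP <-]|[BS /eqP UE]].
  rewrite subsetUl setDUl setDv set0U; split=> //; rewrite eq_sym.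
  by apply/eqP/setDidPl; rewrite disjoint_sym.
rewrite UE setDE setUIr setUCr setIT (setUidPr BS) eqxx; split=> //.
by rewrite -setI_eq0 setICA setICr setI0.
Qed.

(** * The merging order *)

Section OspOrder.
Variable n : nat.
Implicit Types (x y z : osp n) (A B : {set 'I_n}) (p s u v w : seq {set 'I_n}).

Lemma osp_on_osp x : osp_on setT x.
Proof. by rewrite -is_ospE; case: x. Qed.

Lemma osp_of_seq w : osp_on setT w -> {x : osp n | x = w :> seq _}.
Proof.
rewrite -is_ospE => wP; have wn := size_is_osp wP.
by exists (@Osp n (@Bseq n _ w wn) wP).
Qed.

Lemma osp_inj x y : x = y :> seq _ -> x = y.
Proof. by move=> xy; do 2!apply: val_inj. Qed.

Lemma merge_adjacentP x y :
  reflect (exists p A B s, x = p ++ A :: B :: s :> seq _ /\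
             y = p ++ (A :|: B) :: s :> seq _)
          (merge_adjacent x y).
Proof.
apply: (iffP existsP).
  case=> i /andP[ix /eqP yE].
  exists (take i x), (nth set0 x i), (nth set0 x i.+1), (drop i.+2 x).
  by rewrite yE -!drop_nth ?cat_take_drop //; apply: ltnW.
case=> p [A [B [s [xE yE]]]].
(* Merge positions are elements of ['I_n], and [x] has at most [n] blocks. *)
have pn : (size p < n)%N.
  have := size_osp_on _ _ _ (osp_on_osp x); rewrite cardsT card_ord xE size_cat /=.
  by apply: leq_trans; rewrite addnS ltnS leq_addr.
exists (Ordinal pn) => /=; rewrite xE yE; apply/andP; split.
  by rewrite size_cat /= !addnS !ltnS leq_addr.
rewrite take_size_cat // !nth_cat ltnn subnn ltnNge leqnSn /= subSn // subnn.
by rewrite drop_cat ltnNge leqW //= subSn ?leqnSn // subSn // subnn /= drop0.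
Qed.

(** The blocks of [v] are absorbed into [A] one merge at a time. *)
Lemma osp_le_collapse x y p A v s :
  x = p ++ A :: v ++ s :> seq _ ->
  y = p ++ (A :|: \bigcup_(B <- v) B) :: s :> seq _ -> osp_le x y.
Proof.
elim: v A x => [|B v IHv] A x xE yE.
  have -> : x = y by apply: osp_inj; rewrite xE yE big_nil setU0.
  exact: connect0.
have := osp_on_osp x; rewrite xE osp_on_merge => /and4P[/osp_of_seq[z zE] _ _ _].
apply: (connect_trans (y := z)); last first.
  by apply: IHv zE _; rewrite yE big_cons setUA.
by apply/connect1/merge_adjacentP; exists p, A, B, (v ++ s).
Qed.

(** The blocks of [w] are reassembled from left to right; the prefix [p] holds those already
    complete. *)
Lemma osp_le_cat x y p u w :
  x = p ++ u :> seq _ -> y = p ++ w :> seq _ -> u \in refinements w ->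
  osp_le x y.
Proof.
elim: w p u x => [|C w IHw] p u x xE yE.
  rewrite inE => /eqP u0; have -> : x = y by apply: osp_inj; rewrite xE yE u0.
  exact: connect0.
case/refinements_consP=> v [u' [uE vC uw]].
have := osp_on_osp y; rewrite yE osp_on_cat /= => /and5P[pS pP C0 CS wS].
have [|z zE] := osp_of_seq (p ++ C :: u').
  by rewrite osp_on_cat /= pS pP C0 CS (osp_on_refinements _ _ _ _ wS).
apply: (connect_trans (y := z)); last first.
  by apply: (IHw (rcons p C) u') => //; rewrite cat_rcons.
have := osp_on_bigcup _ _ _ vC; case: v vC uE => [|A v] vC uE.
  by rewrite big_nil => C0'; rewrite -C0' eqxx in C0.
rewrite big_cons => CE.
by apply: (osp_le_collapse x z p A v u'); rewrite ?xE ?uE ?zE ?CE.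
Qed.

(** For the direct implication, [y] refines itself, and undoing the merges of a chain one by one
    preserves refinement by [refinements_split]. *)
Lemma osp_leE x y : osp_le x y = ((x : seq _) \in refinements y).
Proof.
apply/idP/idP; last exact: (osp_le_cat x y [::]).
case/connectP=> q; elim: q x => [|z q IHq] x /=.
  by move=> _ ->; apply: refinements_refl (osp_on_osp x).
case/andP=> /merge_adjacentP[p [A [B [s [xE zE]]]]] zq yE.
have := osp_on_osp x; rewrite xE osp_on_merge => /and4P[_ A0 B0 AB].
by apply: refinements_split => //; rewrite -zE IHq.
Qed.

Lemma sum_osp (R : pzRingType) (L : seq (seq {set 'I_n})) (P : pred (osp n))
    (F : seq {set 'I_n} -> R) : uniq L ->
    (forall w, w \in L -> osp_on setT w) ->
    (forall x, P x = ((x : seq _) \in L)) ->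
  \sum_(x : osp n | P x) F x = \sum_(w <- L) F w.
Proof.
move=> uL LP PL; rewrite -big_filter.
rewrite -(big_map (fun x : osp n => x : seq _) xpredT F).
apply: perm_big; apply: uniq_perm => //.
  rewrite map_inj_uniq ?filter_uniq ?index_enum_uniq //.
  exact: osp_inj.
move=> w; apply/mapP/idP.
  by case=> x; rewrite mem_filter PL => /andP[+ _] ->.
move=> wL; have [x xE] := osp_of_seq w (LP w wL); exists x => //.
by rewrite mem_filter PL xE wL mem_index_enum.
Qed.

(** Lets a weight that vanishes on inadmissible partitions carry the congruence condition, so that
    unrestricted enumerations apply. *)
Lemma sum_osp_mod (R : pzRingType) d (P : pred (osp n)) (F : osp n -> R) :
    (forall x : osp n, ~~ all (fun B : {set 'I_n} => #|B| == 1 %[mod d]) x -> F x = 0) ->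
  \sum_(x : osp_mod d n | P x) F x = \sum_(x : osp n | P x) F x.
Proof.
move=> F0.
rewrite [RHS](bigID (fun x : osp n =>
  all (fun B : {set 'I_n} => #|B| == 1 %[mod d]) x)) /=.
rewrite [X in _ = _ + X]big1 ?addr0; last by move=> x /andP[_ /F0].
rewrite [RHS](reindex_omap (fun x : osp_mod d n => x : osp n) insub) /=.
  by apply: eq_bigl => x; rewrite valK eqxx andbT (valP x) andbT.
by move=> x /andP[_ xd]; rewrite insubT.
Qed.

End OspOrder.

(** * The numbers [breve_E] *)

Section BreveE.
Variable d : nat.
Hypothesis d_gt0 : (0 < d)%N.

Let F := F_series d.

Let G : fps rat := F * fps_comp (kCatalan_series d) (- F ^+ d).

Let eta (n : nat) : rat := coefs G n * n`!%:R.

Let coefsF0 : coefs F 0 = 0.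
Proof. by []. Qed.

Let coefsFd0 : coefs (- F ^+ d) 0 = 0.
Proof. by rewrite coefsN coefs_exp_eq0 ?oppr0. Qed.

Let supp_F : mod_supp d 1 F.
Proof.
by move=> n; rewrite /F /=; case: ifP => [/andP[_ /eqP]//|_]; rewrite eqxx.
Qed.

Let supp_G : mod_supp d 1 G.
Proof.
rewrite -[1%N]addn0; apply: mod_suppM => //; apply: mod_supp_comp.
apply: mod_suppN => n /(mod_supp_exp _ _ _ _ _ supp_F) ->.
by rewrite muln1 modnn mod0n.
Qed.

Let coefsG0 : coefs G 0 = 0.
Proof. by rewrite coefsM big_ord1 coefsF0 mul0r. Qed.

(** The Catalan equation [c = 1 + t c^d] at [t = - F^d], times [F], since [F^d c^d = G^d]. *)
Let G_eq : G = F * (1 - G ^+ d).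
Proof.
rewrite {1}/G {1}comp_kCatalan //; congr (_ * (1 + _)).
by rewrite mulNr -exprMn.
Qed.

(** Only exponents [d k + 1] contribute in degree [m]. By [G_eq] these powers form a geometric sum
    that telescopes to [F - F * G ^+ (d * m.+1)]. *)
Let sum_G_exp m : (0 < m)%N -> m = 1 %[mod d] ->
  \sum_(l < m.+1) coefs (G ^+ l) m = coefs F m.
Proof.
move=> m0 md.
have := sum_mod_supp rat d (fun=> 1) G m d_gt0 m0 md coefsG0 supp_G.
under eq_bigr => l _ do rewrite mul1r.
move=> ->; under eq_bigr => k _ do rewrite mul1r.
have FE : \sum_(k < m.+1) G ^+ (d * k).+1 = F - F * G ^+ (d * m.+1).
  under eq_bigr => k _ do rewrite exprS exprM.
  rewrite -mulr_sumr {1}G_eq -mulrA exprM -[X in _ = X - _]mulr1 -mulrBr.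
  congr (_ * _); rewrite -[1 in RHS](expr1n _ m.+1) subrXX.
  by congr (_ * _); apply: eq_bigr => i _; rewrite expr1n mul1r.
rewrite -coefs_sum FE coefsD coefsN coefsM.
(* The remainder has order greater than [m]. *)
rewrite [X in _ - X]big1 ?subr0 // => i _.
rewrite coefs_exp_eq0 ?mulr0 //; nia.
Qed.

(** * Weights of partitions and the Möbius function *)

Let egf_eta : egf eta = G.
Proof.
apply/fpsP => -[|n]; first by rewrite coefsG0.
by rewrite /= /eta mulfK // pnatr_eq0 -lt0n fact_gt0.
Qed.

(** With [m = #|S|], the sum is [m!] times the coefficient of [x^m] in the sum of the powers of [G],
    which is that of [F], namely [1 / m!]. *)
Let sum_osps_eta (T : finType) (S : {set T}) : (0 < #|S|)%N -> #|S| = 1 %[mod d] ->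
  \sum_(w <- osps S) \prod_(B <- w) eta #|B| = 1.
Proof.
move=> S0 Sd.
under eq_bigr => w _ do rewrite -[\prod_(_ <- _) _]mul1r.
rewrite (sum_osps _ eta (fun=> 1)) -mulr_suml egf_eta.
under eq_bigr => k _ do rewrite mul1r.
by rewrite sum_G_exp //= S0 Sd eqxx mulVf // pnatr_eq0 -lt0n fact_gt0.
Qed.

Let eta0 k : k <> 1 %[mod d] -> eta k = 0.
Proof.
by rewrite /eta; case: (eqVneq (coefs G k) 0) => [->|/supp_G //]; rewrite mul0r.
Qed.

Let prod_eta0 n (x : osp n) :
  ~~ all (fun B : {set 'I_n} => #|B| == 1 %[mod d]) x ->
  \prod_(B <- x) eta #|B| = 0.
Proof.
case/allPn=> B Bx /eqP Bd; apply/eqP; rewrite prodf_seq_eq0.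
by apply/hasP; exists B => //=; rewrite eta0.
Qed.

(** Inadmissible refinements weigh 0, so the sum runs over all refinements and factors over the
    blocks of [x], each factor being 1. *)
Let sum_le_eta n (x : osp_mod d n) :
  \sum_(z : osp_mod d n | (z <= x)%O) \prod_(B <- z) eta #|B| = 1.
Proof.
transitivity (\sum_(z : osp n | osp_le z x) \prod_(B <- z) eta #|B|).
  exact: (sum_osp_mod n _ d (fun z => osp_le z x)
            (fun z => \prod_(B <- z) eta #|B|) (prod_eta0 n)).
rewrite (sum_osp n _ (refinements x) (fun z => osp_le z x)
           (fun z => \prod_(B <- z) eta #|B|)).
- rewrite sum_refinements big_seq big1 // => B Bx; apply: sum_osps_eta.
    by rewrite card_gt0; case: (osp_on_block _ _ _ _ (osp_on_osp n x) Bx).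
  by case: x Bx => x /= /allP xd /xd /eqP.
- exact: uniq_refinements (osp_on_osp n x).
- by move=> w; apply: osp_on_refinements (osp_on_osp n x).
by move=> z; apply: osp_leE.
Qed.

(** Induction on the size of the strict down-set. The bottom contributes 1 and the partitions
    strictly below [x] contribute minus their total weight, which [sum_le_eta] evaluates as 1 minus
    the weight of [x]. *)
Let mobius_eta n (x : osp_mod d n) :
  (mobius (\bot : breve_Omega d n)%O (Some x))%:~R =
    - \prod_(B <- x) eta #|B|.
Proof.
have [m xm] := ubnP #|[pred z : osp_mod d n | (z < x)%O]|.
elim: m x xm => // m IHm x; rewrite ltnS => xm.
have ltSome (u : osp_mod d n) : ((Some u : breve_Omega d n) < Some x)%O = (u < x)%O.
  by rewrite !lt_def.
rewrite mobius_lt //.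
rewrite (bigD1 (None : breve_Omega d n)) //= mobius_xx.
rewrite (reindex_omap (fun u : osp_mod d n => Some u : breve_Omega d n) id) /=; last first.
  by case.
have := sum_le_eta n x; rewrite (bigD1 x) //= => /(canRL (addrK _)) ->.
rewrite rmorphN rmorphD rmorph_sum -sumrN /=; congr (- (_ + _)).
apply: eq_big => u.
  by rewrite eqxx !andbT ltSome lt_neqAle andbC.
rewrite eqxx !andbT ltSome => ux; apply: IHm.
apply: leq_trans xm; apply/proper_card/properP; split.
  by apply/subsetP=> t; rewrite !inE => tu; apply: lt_trans ux.
by exists u; rewrite !inE // ltxx.
Qed.

(** * The breve numbers and their identities *)

Let breve_E_eta k : (0 < k)%N -> (breve_E d k)%:~R = - eta k.
Proof.
move=> k0; rewrite /breve_E; case: eqP => kd; last by rewrite eta0 // oppr0.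
have [x -> xE] := one_hatE k0 kd.
by rewrite mobius_eta xE big_seq1 cardsT card_ord.
Qed.

Let breve_E_series_eq : breve_E_series d = - G.
Proof.
apply/fpsP => -[|n]; first by rewrite coefsN coefsG0 oppr0.
by rewrite coefsN /= breve_E_eta // mulNr mulfK // pnatr_eq0 -lt0n fact_gt0.
Qed.

Let prod_eta_breve n (x : osp n) :
  \prod_(B <- x) eta #|B| = ((-1) ^+ size x * breve_E_osp d x)%:~R.
Proof.
rewrite rmorphM rmorphXn rmorphN1 /breve_E_osp rmorph_prod /=.
(* Writing the length as a sum of ones gives each block its own sign. *)
rewrite -[size x]count_predT -sum1_count -prodrXr -big_split.
rewrite big_seq [RHS]big_seq; apply: eq_bigr => B Bx /=.
rewrite expr1 mulN1r breve_E_eta ?opprK // card_gt0.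
by case: (osp_on_block _ _ _ _ (osp_on_osp n x) Bx).
Qed.

Let sum_mod_osps n (h : seq {set 'I_n} -> rat) :
  (forall x : osp n, ~~ all (fun B : {set 'I_n} => #|B| == 1 %[mod d]) x -> h x = 0) ->
  \sum_(x : osp_mod d n) h x = \sum_(w <- osps [set: 'I_n]) h w.
Proof.
move=> F0; rewrite (sum_osp_mod n _ d xpredT (fun x => h x)) //.
apply: sum_osp => [|w|x]; rewrite ?uniq_osps ?mem_osps //.
by rewrite osp_on_osp.
Qed.

(** For [d > 1] the floor is [k] and the ceiling [k + 1]. For [d = 1] both are [k + 1], but every
    Catalan number involved is 1. *)
Let term_a k :
  (-1) ^+ ceil_div (d * k).+1 d * kCatalan ((d * k).+1 %/ d) d =
  - ((-1) ^+ k * kCatalan k d).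
Proof.
rewrite /ceil_div; have [d1|d1] := eqVneq d 1%N.
  have C1 m : kCatalan m d = 1.
    by rewrite /kCatalan d1 mul0n mul1n binn mulr1 invr1.
  by rewrite !C1 d1 mul1n divn1 dvd1n addn0 exprS !mulr1 mulN1r.
have {}d1 : (1 < d)%N by rewrite ltn_neqAle eq_sym d1.
rewrite -addn1 mulnC divnMDl // divn_small // addn0 dvdn_addr ?dvdn_mull //.
by rewrite dvdn1 gtn_eqF // addn1 exprS mulN1r mulNr.
Qed.

(** There are [n! [x^n] F^l] admissible partitions with [l] blocks. Only [l = d k + 1] occurs, and
    [term_a] turns the sum into the expansion of [- F * C_d(- F^d) = - G]. *)
Lemma breve_E_sum n : (0 < n)%N -> n = 1 %[mod d] ->
  (breve_E d n)%:~R =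
    \sum_(w : osp_mod d n)
      (-1) ^+ ceil_div (size w) d * kCatalan (size w %/ d) d.
Proof.
move=> n0 nd; rewrite breve_E_eta //.
pose phi l := (-1) ^+ ceil_div l d * kCatalan (l %/ d) d : rat.
(* The congruence becomes a block weight whose exponential generating function is [F]. *)
pose chi k : rat := (k == 1 %[mod d])%:R.
have chi0 (x : osp n) : ~~ all (fun B : {set 'I_n} => #|B| == 1 %[mod d]) x ->
    phi (size x) * \prod_(B <- x) chi #|B| = 0.
  case/allPn=> B Bx Bd; apply/eqP; rewrite mulf_eq0 prodf_seq_eq0.
  by apply/orP; right; apply/hasP; exists B; rewrite //= /chi (negbTE Bd).
have -> : \sum_(w : osp_mod d n) phi (size w) =
    \sum_(w : osp_mod d n) phi (size w) * \prod_(B <- w) chi #|B|.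
  apply: eq_bigr => -[w /= wd] _; rewrite big_seq big1 ?mulr1 // => B Bw.
  by rewrite /chi (allP wd).
rewrite (sum_mod_osps n (fun w => phi (size w) * \prod_(B <- w) chi #|B|) chi0).
rewrite sum_osps cardsT card_ord -mulr_suml.
have -> : egf chi = F.
  apply/fpsP => -[|k] //=; rewrite /chi; case: eqP => _; last by rewrite mul0r.
  by rewrite mul1r.
rewrite (sum_mod_supp _ d phi) // -mulNr; congr (_ * _).
rewrite coefs_mul_comp // -sumrN; apply: eq_bigr => k _.
rewrite /phi term_a mulNr; congr (- _).
by rewrite (exprNn (F ^+ d)) mulrCA -exprM -exprS coefs_signM mulrCA mulrA.
Qed.

(** The total weight of the admissible partitions is 1; the term of the one-block partition is
    [eta n], that is, minus the breve number, and is isolated. *)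
Lemma breve_E_rec n : (0 < n)%N -> n = 1 %[mod d] ->
  breve_E d n =
    -1 + \sum_(w : osp_mod d n | (w : seq {set 'I_n}) != [:: [set: 'I_n]])
           (-1) ^+ size w * breve_E_osp d w.
Proof.
move=> n0 nd; apply: (@intr_inj rat).
have [t _ tE] := one_hatE n0 nd.
have : \sum_(x : osp_mod d n) \prod_(B <- x) eta #|B| = 1.
  rewrite (sum_mod_osps n (fun w => \prod_(B <- w) eta #|B|) (prod_eta0 n)).
  by rewrite sum_osps_eta // cardsT card_ord.
rewrite (bigD1 t) //= tE big_seq1 cardsT card_ord => /(canRL (addKr _)) sumE.
rewrite rmorphD rmorphN1 rmorph_sum /= breve_E_eta //.
rewrite -[LHS](addKr 1) [1 - _]addrC -sumE; congr (_ + _).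
apply: eq_big => x; last by rewrite prod_eta_breve.
congr (~~ _); apply/eqP/eqP => [->//|xE].
by apply/val_inj/osp_inj; rewrite xE tE.
Qed.

Lemma breve_E_seriesE :
  breve_E_series d =
    - F_series d * fps_comp (kCatalan_series d) (- F_series d ^+ d).
Proof. by rewrite breve_E_series_eq mulNr. Qed.

Lemma breve_E_series_rec :
  breve_E_series d =
    - F_series d * (1 - (-1) ^+ d * breve_E_series d ^+ d).
Proof.
by rewrite breve_E_series_eq -exprMn mulN1r opprK mulNr -G_eq.
Qed.

End BreveE.

Theorem mainTheorem16 (d n : nat) (hd : (0 < d)%N) (hn : (0 < n)%N)
    (hdn : n = 1 %[mod d]) :
  [/\ (* (a) *)
      (breve_E d n)%:~R =
        \sum_(w : osp_mod d n)
          (-1) ^+ ceil_div (size w) d * kCatalan (size w %/ d) d,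
      (* (b) *)
      breve_E d n =
        -1 + \sum_(w : osp_mod d n | (w : seq {set 'I_n}) != [:: [set: 'I_n]])
               (-1) ^+ size w * breve_E_osp d w,
      (* (c) *)
      breve_E_series d =
        - F_series d * fps_comp (kCatalan_series d) (- F_series d ^+ d)
    & (* (d) *)
      breve_E_series d =
        - F_series d * (1 - (-1) ^+ d * breve_E_series d ^+ d)].
Proof.
split; [exact: breve_E_sum | exact: breve_E_rec | exact: breve_E_seriesE |].
exact: breve_E_series_rec.
Qed.
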